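(* Let $(\mathbf{X},Y)$, $\mathbf{X}=(X_1,\dots,X_d)$, be a $(d+1)$-dimensional random vector with continuous univariate marginal distribution functions. Then the following properties hold: (i) $T(Y,\mathbf{X})=1$ if and only if $Y$ is completely dependent on $\mathbf{X}$; (ii) $T(Y,\mathbf{X})=0$ if and only if $Y$ and $\mathbf{X}$ are independent; (iii) $T(Y,\mathbf{X})$ is invariant with respect to permutations of $X_1,\dots,X_d$; (iv) $T(Y,\mathbf{X})$ is invariant with respect to continuous and strictly monotone (coordinatewise) transformations of $X_1,\dots,X_d$; (v) $T$ fulfills the information gain inequality, i.e., for all $k\in\{1,\dots,d\}$, $$T(Y,X_1)\le T(Y,(X_1,X_2))\le\dots\le T(Y,(X_1,\dots,X_k))\le\dots\le T(Y,(X_1,\dots,X_d));$$ (vi) for $k\in\{1,\dots,d-1\}$, the identity $T(Y,(X_1,\dots,X_d))=T(Y,(X_1,\dots,X_k))$ holds if and only if $Y$ and the random vector $(X_{k+1},\dots,X_d)$ are conditionally independent given $(X_1,\dots,X_k)$.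
   Context: $d\ge 1$ is an integer. For a random vector $\mathbf{Z}$ (of any dimension) and a random variable $Y$ with continuous distribution function, $$T(Y,\mathbf{Z})=\frac{\int_{\mathbb{R}}\mathrm{var}\big(P(Y\ge y\mid\mathbf{Z})\big)\,\mathrm{d}P^{Y}(y)}{\int_{\mathbb{R}}\mathrm{var}\big(\mathbf{1}_{\{Y\ge y\}}\big)\,\mathrm{d}P^{Y}(y)},$$ where $P^Y$ is the law of $Y$. $Y$ is completely dependent on $\mathbf{X}$ if there is a measurable function $f$ with $P(Y=f(\mathbf{X}))=1$. *)

(* Defs.v *)
From HB Require Import structures.
From mathcomp Require Import all_boot all_order all_algebra perm.
From mathcomp Require Import all_classical all_reals all_analysis.

Set Implicit Arguments.
Unset Strict Implicit.
Unset Printing Implicit Defensive.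

Import Order.TTheory GRing.Theory Num.Theory.
Import numFieldNormedType.Exports.

Local Open Scope classical_set_scope.
Local Open Scope ring_scope.

(* The real-valued function g is a version of P(A | Z), i.e. of the conditional
   expectation of \1_A given the sigma-algebra generated by Z. *)
Definition is_cond_prob {d d'} {T : measurableType d} {E : measurableType d'}
    {R : realType} (P : probability T R) (Z : T -> E) (A : set T)
    (g : T -> R) : Prop :=
  [/\ forall B : set R, measurable B -> g_sigma_algebra_preimage Z (g @^-1` B),
      P.-integrable [set: T] (EFin \o g) &
      forall C : set T, g_sigma_algebra_preimage Z C ->
        (\int[P]_(w in C) (g w)%:E = P (A `&` C))%E].

(* P(A | Z) is only defined up to a P-null set; a version is selected by choice.
   For measurable A and Z one exists by the Radon-Nikodym theorem, so that the
   default value cst 0 is irrelevant. *)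
Definition cond_prob {d d'} {T : measurableType d} {E : measurableType d'}
    {R : realType} (P : probability T R) (Z : T -> E) (A : set T) : T -> R :=
  xget (cst 0) [set g | is_cond_prob P Z A g].

(* Both integrals are finite (variances of [0, 1]-valued variables integrated
   against a probability), so that fine loses no information; the denominator
   is nonzero when the distribution function of Y is continuous. *)
Definition Tdep {d d'} {T : measurableType d} {E : measurableType d'}
    {R : realType} (P : probability T R) (Y : {RV P >-> R}) (Z : T -> E) : R :=
  fine (\int[distribution P Y]_y
          'V_P[cond_prob P Z [set w | (y <= Y w)%R]])%E
  / fine (\int[distribution P Y]_y 'V_P[\1_[set w | (y <= Y w)%R]])%E.

(* The random vector (X_(f 0), ..., X_(f (m - 1))). *)
Definition subvec {d} {T : measurableType d} {R : realType}
    (P : probability T R) {n m : nat} (X : 'I_n -> {RV P >-> R})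
    (f : 'I_m -> 'I_n) (w : T) : m.-tuple R :=
  [tuple X (f i) w | i < m].

Definition vec {d} {T : measurableType d} {R : realType}
    (P : probability T R) {n : nat} (X : 'I_n -> {RV P >-> R}) : T -> n.-tuple R :=
  subvec X id.

(* With 0-based indices, tail_ord enumerates {k, ..., n - 1} in 'I_n. *)
Definition tail_ord {k n : nat} (hk : (k <= n)%N) (i : 'I_(n - k)) : 'I_n :=
  cast_ord (subnKC hk) (rshift k i).

Definition completely_dependent {d d'} {T : measurableType d}
    {E : measurableType d'} {R : realType} (P : probability T R)
    (Y : T -> R) (Z : T -> E) : Prop :=
  exists f : E -> R,
    measurable_fun [set: E] f /\ P [set w | Y w = f (Z w)] = 1%E.

Definition independent_rv {d d1 d2} {T : measurableType d}
    {E1 : measurableType d1} {E2 : measurableType d2} {R : realType}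
    (P : probability T R) (Y : T -> E1) (Z : T -> E2) : Prop :=
  forall (A : set E1) (B : set E2), measurable A -> measurable B ->
    (P (Y @^-1` A `&` Z @^-1` B) = P (Y @^-1` A) * P (Z @^-1` B))%E.

Definition cond_independent_rv {d d1 d2 d3} {T : measurableType d}
    {E1 : measurableType d1} {E2 : measurableType d2} {E3 : measurableType d3}
    {R : realType} (P : probability T R)
    (Y : T -> E1) (Z : T -> E2) (W : T -> E3) : Prop :=
  forall (A : set E1) (B : set E2), measurable A -> measurable B ->
    {ae P, forall w,
      cond_prob P W (Y @^-1` A `&` Z @^-1` B) w =
      cond_prob P W (Y @^-1` A) w * cond_prob P W (Z @^-1` B) w}.

Definition strictly_monotone {R : realType} (g : R -> R) : Prop :=
  {homo g : x y / x < y} \/ {homo g : x y / x < y >-> y < x}.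

(* Main.v *)
Require Import Defs.
From HB Require Import structures.
From mathcomp Require Import all_boot all_order all_algebra perm.
From mathcomp Require Import all_classical all_reals all_analysis.
From mathcomp Require Import measurable_realfun.
From mathcomp Require Import ring lra.

Set Implicit Arguments.
Unset Strict Implicit.
Unset Printing Implicit Defensive.

Import Order.TTheory GRing.Theory Num.Theory.
Import numFieldNormedType.Exports.

Local Open Scope classical_set_scope.
Local Open Scope ring_scope.

(** For an event A and an explanatory variable Z, write p_A(Z) for the
   conditional probability of A given Z.  It is the orthogonal projection of
   the indicator of A on the square-integrable functions of Z.  Hence, if W is
   a function of Z,
     E (1_A - p_A(Z))^2 = P(A) - E p_A(Z)^2,
     E (p_A(Z) - P(A))^2 = E p_A(Z)^2 - P(A)^2 = var p_A(Z),
     E (p_A(Z) - p_A(W))^2 = E p_A(Z)^2 - E p_A(W)^2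
   ([dist_indic_regr], [dist_cst_regr], [dist_regr_coarsening]).  Applied to
   the events A = {Y >= y}, they show that var p_A(Z) lies between 0 and
   var 1_A, increases with the information in Z, and say what each case of
   equality means: p_A(Z) is constant, equals 1_A, or equals p_A(W), almost
   surely.  This is the information gain inequality, and it reduces the three
   equivalences to a statement for each threshold y, provided that equality of
   the integrals over y forces equality of the integrands at every y.

   A vanishing integral of a nonnegative function only gives P^Y-almost every
   y.  The gap is closed by continuity: y |-> E p_{Y >= y}(Z)^2 varies by at
   most twice the variation of the distribution function of Y
   ([second_moment_lip]), and a nonnegative function with that property and
   zero P^Y-integral vanishes identically ([expect_law_eq0]), because the
   distribution function is continuous and takes all values in ]0, 1[.  The
   same estimate makes all integrands measurable, and the denominator is
   positive for the same reason ([Tden_gt0]).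

   It remains to interpret the statements that hold for each threshold.

   - If 1_{Y >= y} is almost surely a function of Z for every rational y, then
     Y is the supremum of the rational y with p_{Y >= y}(Z) = 1, which is a
     measurable function of Z ([ge_moment_completely_dependent]).
   - If p_{Y >= y}(Z) is constant for every y, the rays [y, +oo[ being a
     generating pi-system, Y and Z are independent ([ge_moment_independent]).
   - If p_{Y >= y}(W, V) = p_{Y >= y}(W) for every y, the product of the
     conditional probabilities given W of {Y >= y} and {V in B} is a version of
     that of the intersection; the same pi-lambda argument extends this to all
     Borel sets.  The converse is a pi-lambda argument over the sets
     {W in C, V in B}, which generate the sigma-algebra of (W, V)
     ([regr_cond_independent], [cond_independent_regr]).

   Finally, conditional probabilities see Z only through the sigma-algebra that
   it generates ([Tdep_eq_sigma]).  Permutations and strictly monotone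
   transformations of the coordinates leave that sigma-algebra unchanged. *)

(** * Bounded measurable functions and their expectation *)

(** All integrands below are polynomials in indicators and conditional
   probabilities.  Boundedness is stable under products, unlike integrability,
   so that expectations can be real numbers throughout. *)
Definition bmfun {d} {T : measurableType d} {R : realType} (f : T -> R) : Prop :=
  measurable_fun [set: T] f /\ exists M : R, forall x, `|f x| <= M.

Section bounded_measurable_functions.
Context {d} {T : measurableType d} {R : realType}.
Implicit Types f g : T -> R.

Lemma bmfun_cst (c : R) : bmfun (fun _ : T => c).
Proof. by split => //; exists `|c|. Qed.

Lemma bmfun01 f : measurable_fun setT f -> (forall x, 0 <= f x <= 1) -> bmfun f.
Proof.
move=> mf f01; split => //; exists 1 => x.
by have /andP[f0 f1] := f01 x; rewrite ger0_norm.
Qed.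

Lemma bmfun_indic (A : set T) : measurable A -> bmfun (\1_A : T -> R).
Proof.
move=> mA; apply: bmfun01 => // x.
by rewrite indicE ler0n lern1 leq_b1.
Qed.

Lemma bmfunD f g : bmfun f -> bmfun g -> bmfun (fun x => f x + g x).
Proof.
move=> [mf [M fM]] [mg [N gN]]; split; first exact: measurable_funD.
by exists (M + N) => x; rewrite (le_trans (ler_normD _ _))// lerD.
Qed.

Lemma bmfunM f g : bmfun f -> bmfun g -> bmfun (fun x => f x * g x).
Proof.
move=> [mf [M fM]] [mg [N gN]]; split; first exact: measurable_funM.
by exists (M * N) => x; rewrite normrM ler_pM.
Qed.

Lemma bmfunB f g : bmfun f -> bmfun g -> bmfun (fun x => f x - g x).
Proof.
move=> [mf [M fM]] [mg [N gN]]; split; first exact: measurable_funB.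
by exists (M + N) => x; rewrite (le_trans (ler_normB _ _))// lerD.
Qed.

Lemma bmfun_sqr f : bmfun f -> bmfun (fun x => f x ^+ 2).
Proof. by move=> bf; under eq_fun do rewrite expr2; exact: bmfunM. Qed.

End bounded_measurable_functions.

Lemma measurable_preimage {d d'} {T : measurableType d}
    {E : measurableType d'} (f : T -> E) (B : set E) :
  measurable_fun setT f -> measurable B -> measurable (f @^-1` B).
Proof. by move=> mf mB; rewrite -[X in measurable X]setTI; exact: mf. Qed.

Lemma bmfun_comp {d d'} {T : measurableType d} {E : measurableType d'}
    {R : realType} (Z : T -> E) (h : E -> R) :
  measurable_fun setT Z -> bmfun h -> bmfun (h \o Z).
Proof.
move=> mZ [mh [M hM]]; split; first exact: measurableT_comp.
by exists M => x; exact: hM.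
Qed.

Lemma bmfun_integrable {d} {T : measurableType d} {R : realType}
    (mu : {finite_measure set T -> \bar R}) (f : T -> R) (D : set T) :
  measurable D -> bmfun f -> mu.-integrable D (EFin \o f).
Proof.
move=> mD [mf [M fM]]; apply: measurable_bounded_integrable => //.
- by rewrite -ge0_fin_numE ?fin_num_measure.
- exact: measurable_funTS.
- exists M; split; first by rewrite num_real.
  by move=> N MN x _ /=; rewrite (le_trans (fM x))// ltW.
Qed.

Definition expect {d} {T : measurableType d} {R : realType}
  (P : probability T R) (f : T -> R) : R := \int[P]_w f w.

Section expectation_of_bounded_functions.
Context {d} {T : measurableType d} {R : realType} (P : probability T R).
Implicit Types (f g : T -> R) (A D : set T).
Local Notation "'E f" := (expect P f) (at level 10, f at level 8).

Lemma EFin_expect f : bmfun f -> (\int[P]_w (f w)%:E)%E = ('E f)%:E.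
Proof.
by move=> bf; rewrite fineK//; apply: integrable_fin_num => //;
  exact: bmfun_integrable.
Qed.

Lemma expectD f g : bmfun f -> bmfun g ->
  'E (fun w => f w + g w) = 'E f + 'E g.
Proof. by move=> bf bg; apply: RintegralD => //; exact: bmfun_integrable. Qed.

Lemma expectB f g : bmfun f -> bmfun g ->
  'E (fun w => f w - g w) = 'E f - 'E g.
Proof. by move=> bf bg; apply: RintegralB => //; exact: bmfun_integrable. Qed.

Lemma expectZ (c : R) f : bmfun f -> 'E (fun w => c * f w) = c * 'E f.
Proof. by move=> bf; apply: RintegralZl => //; exact: bmfun_integrable. Qed.

Lemma expect_cst (c : R) : 'E (fun _ => c) = c.
Proof.
rewrite /expect Rintegral_cst// (_ : _ [set: T] = 1%E) ?mulr1//.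
exact: probability_setT.
Qed.

Lemma le_expect f g : bmfun f -> bmfun g -> (forall w, f w <= g w) ->
  'E f <= 'E g.
Proof.
by move=> bf bg fg; apply: le_Rintegral => //; exact: bmfun_integrable.
Qed.

Lemma expect_ge0 f : (forall w, 0 <= f w) -> 0 <= 'E f.
Proof. by move=> f0; apply: Rintegral_ge0. Qed.

Lemma eq_expect f g : f =1 g -> 'E f = 'E g.
Proof. by move=> /funext ->. Qed.

Lemma expect_indic A : measurable A -> 'E \1_A = fine (P A).
Proof. by move=> mA; rewrite /expect /Rintegral integral_indic// setIT. Qed.

Lemma expect_indicM f A : measurable A ->
  (\int[P]_(w in A) (f w)%:E)%E = (\int[P]_w (f w * \1_A w)%:E)%E.
Proof.
move=> mA; rewrite integral_mkcond; apply: eq_integral => w _.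
rewrite patchE indicE; case: (w \in A); first by rewrite mulr1.
by rewrite mulr0.
Qed.

Lemma ae_eq_expect f g : bmfun f -> bmfun g ->
  {ae P, forall w, f w = g w} -> 'E f = 'E g.
Proof.
move=> [mf _] [mg _] fg; congr fine; apply: ae_eq_integral => //.
- exact/measurable_EFinP.
- exact/measurable_EFinP.
- by apply: filterS fg => w -> .
Qed.

Lemma expect_eq0 f : bmfun f -> (forall w, 0 <= f w) -> 'E f = 0 ->
  {ae P, forall w, f w = 0}.
Proof.
move=> bf f0 Ef0.
have mf : measurable_fun setT (EFin \o f) by apply/measurable_EFinP; case: bf.
have : (\int[P]_w `|(EFin \o f) w| = 0)%E.
  under eq_integral do rewrite gee0_abs ?lee_fin//.
  by rewrite EFin_expect// Ef0.
move/(ae_eq_integral_abs P measurableT mf).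
by apply: filterS => w /(_ I) [].
Qed.

(** The cases of equality in the theorem are all detected by this criterion. *)
Lemma ae_eq_sqr f g : bmfun f -> bmfun g ->
  'E (fun w => (f w - g w) ^+ 2) = 0 -> {ae P, forall w, f w = g w}.
Proof.
move=> bf bg /expect_eq0 h.
move: (bmfun_sqr (bmfunB bf bg)) => /h /(_ (fun w => sqr_ge0 _)).
apply: filterS => w /eqP.
by rewrite sqrf_eq0 subr_eq0 => /eqP.
Qed.

Lemma expect_sqrB f g : bmfun f -> bmfun g ->
  'E (fun w => (f w - g w) ^+ 2) =
  'E (fun w => f w ^+ 2) - 2 * 'E (fun w => f w * g w) + 'E (fun w => g w ^+ 2).
Proof.
move=> bf bg; have bfg := bmfunM bf bg.
have bff := bmfun_sqr bf; have bgg := bmfun_sqr bg.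
have b2 : bmfun (fun w => 2 * (f w * g w)) by exact: bmfunM (bmfun_cst 2) bfg.
rewrite -expectZ// -expectB// -expectD//; last exact: bmfunB.
by apply: eq_expect => w; ring.
Qed.

Lemma expect_indic_sqr A : measurable A -> 'E (fun w => \1_A w ^+ 2) = fine (P A).
Proof.
move=> mA; rewrite -expect_indic//; apply: eq_expect => w.
by rewrite indicE; case: (w \in A); rewrite ?expr1n ?expr0n.
Qed.

End expectation_of_bounded_functions.

(** * Conditional probability as a function of the conditioning variable *)

Section negative_part.
Context {d} {E : measurableType d} {R : realType}.
Implicit Type h : E -> R.

Lemma measurable_neg_part h :
  measurable_fun setT h -> measurable [set z | h z < 0].
Proof.
move=> mh; rewrite (_ : [set z | _] = h @^-1` `]-oo, 0[).
  exact: measurable_preimage.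
by apply/seteqP; split => z /=; rewrite in_itv.
Qed.

(** On the set where [h] is negative, the integral of [|h|] is minus that of
   [h], hence vanishes.  This compares two functions whose integrals are known
   on a sigma-algebra that contains the set where one exceeds the other. *)
Lemma ae_ge0_integral_neg_part (mu : {measure set E -> \bar R}) h :
  mu.-integrable setT (EFin \o h) ->
  (0 <= \int[mu]_(z in [set z | (h z < 0)%R]) (h z)%:E)%E ->
  {ae mu, forall z, (0 <= h z)%R}.
Proof.
move=> ih B0; set B := [set z | h z < 0] in B0.
have mh : measurable_fun setT h.
  by apply/measurable_EFinP; exact: measurable_int ih.
have mB : measurable B by exact: measurable_neg_part.
have mhB : measurable_fun B (EFin \o h).
  by apply/measurable_EFinP; exact: measurable_funTS.
have : (\int[mu]_(z in B) `|(EFin \o h) z| = 0)%E.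
  apply/eqP; rewrite eq_le; apply/andP; split; last exact: integral_ge0.
  rewrite (eq_integral (fun z => (-1)%:E * (EFin \o h) z)%E); last first.
    move=> z; rewrite inE => /= hz.
    by rewrite -EFinM mulN1r ltr0_norm.
  rewrite integralZl//; last exact: integrableS ih.
  by rewrite mulN1e oppe_le0.
move=> /(ae_eq_integral_abs mu mB mhB); apply: filterS => z hz0.
by rewrite leNgt; apply/negP => hz; move: (hz0 hz) => -[/eqP]; rewrite lt_eqF.
Qed.

End negative_part.

Section regression.
Context {d d'} {T : measurableType d} {E : measurableType d'} {R : realType}
  (P : probability T R).
Implicit Types (Z : T -> E) (A : set T) (h : E -> R).
Local Notation "'E f" := (expect P f) (at level 10, f at level 8).

(** [h] is a version of the function that maps [z] to the probability of [A]
   given [Z = z].  It is tested against all bounded functions and bounded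
   everywhere, not only almost everywhere, so that it can itself serve as a
   test function. *)
Definition is_regression Z A h : Prop :=
  [/\ measurable_fun [set: E] h, forall z, 0 <= h z <= 1 &
      forall k : E -> R, bmfun k ->
        'E (fun w => h (Z w) * k (Z w)) = 'E (fun w => \1_A w * k (Z w))].

(** The density of the restriction of [P] to [A] with respect to [P] is the
   indicator of [A]; the claim is the change of variables formula for that
   density. *)
Lemma integral_mfrestr A (mA : measurable A) (PA : (P A < +oo)%E) (f : T -> R) :
  bmfun f -> (\int[mfrestr mA PA]_w (f w)%:E)%E = ('E (fun w => \1_A w * f w))%:E.
Proof.
move=> bf.
have [mf _] := bf.
pose nu : {finite_measure set T -> \bar R} := mfrestr mA PA.
have numu : nu `<< P.
  apply/null_content_dominatesP => B mB mB0.
  apply/eqP; rewrite -measure_le0 -[leRHS]mB0.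
  change (P (B `&` A) <= P B)%E.
  by rewrite le_measure// ?inE//; exact: measurableI.
rewrite -(@Radon_Nikodym_change_of_variables _ _ _ nu P numu (EFin \o f))//;
  last exact: bmfun_integrable.
rewrite -EFin_expect; last exact: bmfunM (bmfun_indic mA) bf.
apply: ae_eq_integral => //.
- by apply: emeasurable_funM; [exact/measurable_EFinP|].
- by apply/measurable_EFinP; exact: measurable_funM.
have : ae_eq P setT (EFin \o \1_A)
    (Radon_Nikodym (charge_of_finite_measure nu) P).
  apply: integral_ae_eq => //; first exact: integrable_indic.
  move=> B _ mB; rewrite -Radon_Nikodym_integral// integral_indic//.
  by rewrite setIC.
by apply: filterS => w /(_ I) /= <- _; rewrite EFinM muleC.
Qed.

(** The law of [Z0] on [A] is absolutely continuous with respect to the law of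
   [Z0]; [h] is its density. *)
Lemma integrable_regression (Z0 : {mfun T >-> E}) A : measurable A ->
  exists h : E -> R,
  (distribution P Z0).-integrable setT (EFin \o h) /\
   forall k : E -> R, bmfun k ->
     (\int[distribution P Z0]_z (k z * h z)%:E =
      ('E (fun w => \1_A w * k (Z0 w)))%:E)%E.
Proof.
move=> mA.
have PA : (P A < +oo)%E by rewrite (le_lt_trans (probability_le1 _ _)) ?ltry.
pose mu := distribution P Z0.
pose nu0 := pushforward (mfrestr mA PA) Z0.
have nu0fin : fin_num_fun nu0.
  by move=> B mB; apply: fin_num_measure; exact: measurable_funPTI.
pose H0 := Measure_isFinite.Build _ _ _ nu0 nu0fin.
have mZ0 : measurable_fun setT Z0 by [].
pose nuf : {finite_measure set E -> \bar R} := HB.pack nu0 (H0 mZ0).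
pose nu := nuf mZ0.
have numu : nu `<< mu.
  apply/null_content_dominatesP => B mB mB0.
  apply/eqP; rewrite -measure_le0 -[leRHS]mB0.
  change (P (Z0 @^-1` B `&` A) <= P (Z0 @^-1` B))%E.
  rewrite le_measure// ?inE//.
    by apply: measurableI => //; exact: measurable_funPTI.
  exact: measurable_funPTI.
pose r := Radon_Nikodym (charge_of_finite_measure nu) mu.
exists (fine \o r); split.
  have -> : EFin \o (fine \o r) = r.
    by apply/funext => z /=; rewrite fineK//; exact: Radon_Nikodym_fin_num.
  exact: Radon_Nikodym_integrable.
move=> k bk.
under eq_integral do rewrite EFinM /= fineK ?Radon_Nikodym_fin_num//.
have ik : nu.-integrable setT (EFin \o k) by exact: bmfun_integrable.
rewrite (Radon_Nikodym_change_of_variables numu measurableT ik).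
have -> : (\int[nu]_z (EFin \o k) z = \int[mfrestr mA PA]_w (k (Z0 w))%:E)%E.
  rewrite integral_pushforward//; first by apply/measurable_EFinP; case: bk.
  by rewrite preimage_setT; exact: bmfun_integrable (bmfun_comp mZ0 bk).
by rewrite integral_mfrestr//; exact: bmfun_comp.
Qed.

(** The density of [integrable_regression] lies between 0 and 1 almost
   everywhere, so truncating it does not change any integral. *)
Lemma regression_exists Z A : measurable_fun setT Z -> measurable A ->
  exists h, is_regression Z A h.
Proof.
move=> mZ mA; pose Z0 : {mfun T >-> E} := mfun_Sub (mem_set mZ).
have [h [ih hE]] := integrable_regression Z0 mA.
pose mu : probability E R := distribution P Z0.
have mh : measurable_fun setT h.
  by apply/measurable_EFinP; exact: measurable_int ih.
have mu_comp f : bmfun f -> expect mu f = 'E (f \o Z).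
  move=> bf; congr fine; rewrite integral_pushforward//.
    by apply/measurable_EFinP; case: bf.
  by rewrite preimage_setT; exact: bmfun_integrable (bmfun_comp mZ bf).
have hB (B : set E) : measurable B -> (\int[mu]_(z in B) (h z)%:E =
    ('E (fun w => \1_A w * \1_B (Z w)))%:E)%E.
  move=> mB; rewrite expect_indicM//; under eq_integral do rewrite mulrC.
  by rewrite hE//; exact: bmfun_indic.
have ih1 : mu.-integrable setT (EFin \o (fun z => 1 - h z)).
  rewrite (_ : EFin \o _ = (EFin \o cst 1%R) \- (EFin \o h))%E//.
  by apply: integrableB => //; apply: bmfun_integrable => //; exact: bmfun_cst.
have h_ge0 : {ae mu, forall z, 0 <= h z}.
  apply: ae_ge0_integral_neg_part => //; rewrite hB.
    by rewrite lee_fin expect_ge0// => w; rewrite mulr_ge0// indicE ler0n.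
  exact: measurable_neg_part.
have h_le1 : {ae mu, forall z, 0 <= 1 - h z}.
  apply: ae_ge0_integral_neg_part => //; set B := [set z | _].
  have mB : measurable B.
    by apply: measurable_neg_part; exact: measurable_funB.
  under eq_integral do rewrite EFinB.
  rewrite integralB//; last 2 first.
  - by apply: bmfun_integrable => //; exact: bmfun_cst.
  - exact: integrableS ih.
  rewrite hB// expect_indicM// EFin_expect; last first.
    by apply: bmfunM; [exact: bmfun_cst|exact: bmfun_indic].
  rewrite mu_comp; last by apply: bmfunM; [exact: bmfun_cst|exact: bmfun_indic].
  have bBZ : bmfun (\1_B \o Z : T -> R).
    by apply: bmfun_comp => //; exact: bmfun_indic.
  rewrite -EFinB lee_fin subr_ge0; apply: le_expect.
  - by apply: bmfunM => //; exact: bmfun_indic.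
  - by apply: bmfunM => //; exact: bmfun_cst.
  - by move=> w; rewrite /= ler_wpM2r// !indicE ?ler0n.
pose c z := Num.max 0 (Num.min 1 (h z)).
have mc : measurable_fun setT c.
  by apply: measurable_maxr => //; exact: measurable_minr.
have c01 z : 0 <= c z <= 1 by rewrite /c le_max lexx ge_max ler01 ge_min lexx.
have bc : bmfun c by exact: bmfun01.
exists c; split => // k bk.
have := mu_comp _ (bmfunM bc bk); rewrite /= => <-.
apply: EFin_inj; rewrite -hE// -EFin_expect; last by apply: bmfunM.
apply: ae_eq_integral => //.
- by apply/measurable_EFinP; case: (bmfunM bc bk).
- by apply/measurable_EFinP; apply: measurable_funM => //; case: bk.
- apply: filterS2 h_ge0 h_le1 => z h0 h1 _ /=.
  by rewrite /c min_r -1?subr_ge0// max_r// mulrC.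
Qed.

Definition regr Z A : E -> R := xget (cst 0) [set h | is_regression Z A h].

Lemma regrP Z A : measurable_fun setT Z -> measurable A ->
  is_regression Z A (regr Z A).
Proof. by move=> mZ mA; apply: xgetPex; exact: regression_exists. Qed.

Lemma bmfun_regr Z A : measurable_fun setT Z -> measurable A ->
  bmfun (regr Z A).
Proof. by move=> mZ mA; have [? ? _] := regrP mZ mA; exact: bmfun01. Qed.

Lemma regr_comp_bmfun Z A : measurable_fun setT Z -> measurable A ->
  bmfun (regr Z A \o Z).
Proof. by move=> mZ mA; apply: bmfun_comp => //; exact: bmfun_regr. Qed.

End regression.

(** * Versions of a conditional probability and their variance *)

Section versions_of_conditional_probability.
Context {d d'} {T : measurableType d} {E : measurableType d'} {R : realType}
  (P : probability T R).
Implicit Types (Z : T -> E) (A : set T) (g : T -> R).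
Local Notation "'E f" := (expect P f) (at level 10, f at level 8).

Lemma measurable_sub_sigma Z (D : set T) : measurable_fun setT Z ->
  g_sigma_algebra_preimage Z D -> measurable D.
Proof. by move=> mZ [B mB <-]; exact: mZ. Qed.

Lemma is_cond_prob_measurable Z A g : measurable_fun setT Z ->
  is_cond_prob P Z A g -> measurable_fun setT g.
Proof.
move=> mZ [mg _ _] _ B mB; rewrite setTI.
exact: measurable_sub_sigma mZ (mg _ mB).
Qed.

(** Both functions are measurable for the sigma-algebra generated by [Z], hence
   so is the set where the first is smaller, and on that set both have the same
   integral. *)
Lemma is_cond_prob_ge Z A g1 g2 : measurable_fun setT Z -> measurable A ->
  is_cond_prob P Z A g1 -> is_cond_prob P Z A g2 ->
  {ae P, forall w, 0 <= g1 w - g2 w}.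
Proof.
move=> mZ mA cg1 cg2; have [mg1 ig1 Pg1] := cg1; have [mg2 ig2 Pg2] := cg2.
apply: ae_ge0_integral_neg_part.
  rewrite (_ : EFin \o _ = (EFin \o g1) \- (EFin \o g2))%E//.
  exact: integrableB.
set D := [set w | _].
have sD : g_sigma_algebra_preimage Z D.
  have mg g : (forall B : set R, measurable B ->
        g_sigma_algebra_preimage Z (g @^-1` B)) ->
      measurable_fun [set: g_sigma_algebra_preimageType Z] g.
    by move=> mg _ B mB; rewrite setTI; exact: mg.
  apply: (@measurable_neg_part _ (g_sigma_algebra_preimageType Z)).
  by apply: measurable_funB; exact: mg.
have mD := measurable_sub_sigma mZ sD.
under eq_integral do rewrite EFinB.
rewrite integralB//; [|exact: integrableS ig1|exact: integrableS ig2].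
rewrite Pg1// Pg2// subee// fin_num_measure//.
exact: measurableI.
Qed.

Lemma is_cond_prob_ae_eq Z A g1 g2 : measurable_fun setT Z -> measurable A ->
  is_cond_prob P Z A g1 -> is_cond_prob P Z A g2 ->
  {ae P, forall w, g1 w = g2 w}.
Proof.
move=> mZ mA c1 c2.
apply: filterS2 (is_cond_prob_ge mZ mA c1 c2) (is_cond_prob_ge mZ mA c2 c1) => w.
by rewrite !subr_ge0 => h1 h2; apply/eqP; rewrite eq_le h1 h2.
Qed.

Lemma is_cond_prob_comp Z A h : measurable_fun setT Z -> measurable A ->
  bmfun h -> (forall B, measurable B ->
    'E (fun w => h (Z w) * \1_B (Z w)) = 'E (fun w => \1_A w * \1_B (Z w))) ->
  is_cond_prob P Z A (h \o Z).
Proof.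
move=> mZ mA bh hB; have [mh _] := bh; split.
- move=> B mB; exists (h @^-1` B); last by rewrite setTI.
  exact: measurable_preimage.
- by apply: bmfun_integrable => //; exact: bmfun_comp.
- move=> _ [B mB <-]; rewrite setTI.
  have mZB : measurable (Z @^-1` B) by exact: measurable_preimage.
  have bhB := bmfunM (bmfun_comp mZ bh) (bmfun_indic mZB).
  rewrite expect_indicM// (EFin_expect P bhB).
  rewrite -(fineK (fin_num_measure P _ (measurableI _ _ mA mZB))).
  rewrite -expect_indic; last exact: measurableI.
  congr EFin; rewrite [LHS]hB//.
  by rewrite indicI.
Qed.

Lemma is_cond_prob_regr Z A : measurable_fun setT Z -> measurable A ->
  is_cond_prob P Z A (regr P Z A \o Z).
Proof.
move=> mZ mA; apply: is_cond_prob_comp => //; first exact: bmfun_regr.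
by move=> B mB; have [_ _ ->//] := regrP P mZ mA; exact: bmfun_indic.
Qed.

Lemma cond_probP Z A : measurable_fun setT Z -> measurable A ->
  is_cond_prob P Z A (cond_prob P Z A).
Proof.
move=> mZ mA; apply: xgetPex.
by exists (regr P Z A \o Z); exact: is_cond_prob_regr.
Qed.

Lemma cond_prob_regr Z A : measurable_fun setT Z -> measurable A ->
  {ae P, forall w, cond_prob P Z A w = regr P Z A (Z w)}.
Proof.
move=> mZ mA; apply: (is_cond_prob_ae_eq mZ mA); first exact: cond_probP.
exact: is_cond_prob_regr.
Qed.

Lemma variance_bmfun g : bmfun g ->
  ('V_P[g] = ('E (fun w => g w ^+ 2) - ('E g) ^+ 2)%:E)%E.
Proof.
move=> bg; rewrite /variance !unlock/= /mul_fun.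
have -> : fine (\int[P]_w (g w)%:E)%E = 'E g by [].
set c := 'E g.
rewrite (eq_integral (fun w => (g w * g w - (2 * c * g w - c ^+ 2))%:E));
  last first.
  move=> w _ /=; congr EFin.
  by transitivity ((g w - c) * (g w - c)); [|ring].
have bgg := bmfunM bg bg.
have bcg : bmfun (fun w => 2 * c * g w) by apply: bmfunM => //; exact: bmfun_cst.
have bc2 : bmfun (fun _ : T => c ^+ 2) by exact: bmfun_cst.
rewrite EFin_expect; last exact: bmfunB bgg (bmfunB bcg bc2).
rewrite expectB //; last exact: bmfunB bcg bc2.
rewrite expectB // expectZ // expect_cst -/c; congr EFin.
by under [in RHS]eq_expect do rewrite expr2; ring.
Qed.

Lemma ae_eq_variance g1 g2 : measurable_fun setT g1 -> measurable_fun setT g2 ->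
  {ae P, forall w, g1 w = g2 w} -> 'V_P[g1] = 'V_P[g2].
Proof.
move=> mg1 mg2 g12; rewrite /variance !unlock/= /mul_fun.
have -> : (\int[P]_w (g1 w)%:E = \int[P]_w (g2 w)%:E)%E.
  apply: ae_eq_integral => //; try by apply/measurable_EFinP.
  by apply: filterS g12 => w ->.
apply: ae_eq_integral => //.
- by apply/measurable_EFinP; apply: measurable_funM; exact: measurable_funB.
- by apply/measurable_EFinP; apply: measurable_funM; exact: measurable_funB.
- apply: filterS g12 => w gw _; set c := fine _.
  by rewrite -[LHS]/(((g1 w - c) * (g1 w - c))%:E) gw.
Qed.

Lemma expect_regr Z A : measurable_fun setT Z -> measurable A ->
  'E (regr P Z A \o Z) = fine (P A).
Proof.
move=> mZ mA; have [_ _ /(_ _ (bmfun_cst 1))] := regrP P mZ mA.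
under eq_expect do rewrite mulr1; move=> ->.
by under eq_expect do rewrite mulr1; rewrite expect_indic.
Qed.

(** The part of the variance of the conditional probability that depends on
   [Z]: see [variance_cond_prob]. *)
Definition second_moment Z A := 'E (fun w => regr P Z A (Z w) ^+ 2).

Lemma variance_cond_prob Z A : measurable_fun setT Z -> measurable A ->
  ('V_P[cond_prob P Z A] = (second_moment Z A - fine (P A) ^+ 2)%:E)%E.
Proof.
move=> mZ mA; rewrite (ae_eq_variance _ _ (cond_prob_regr mZ mA)).
- by rewrite variance_bmfun ?expect_regr//; exact: regr_comp_bmfun.
- exact: is_cond_prob_measurable mZ (cond_probP mZ mA).
- by have [] := regr_comp_bmfun P mZ mA.
Qed.

End versions_of_conditional_probability.

(** * Projection identities *)

Section second_moment_theory.
Context {d d'} {T : measurableType d} {E : measurableType d'} {R : realType}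
  (P : probability T R).
Variables (Z : T -> E) (mZ : measurable_fun setT Z).
Implicit Types (A : set T).
Local Notation "'E f" := (expect P f) (at level 10, f at level 8).
Local Notation prob A := (fine (P A)).

Lemma expect_regrM A (k : E -> R) : measurable A -> bmfun k ->
  'E (fun w => regr P Z A (Z w) * k (Z w)) = 'E (fun w => \1_A w * k (Z w)).
Proof. by move=> mA bk; have [_ _ ->] := regrP P mZ mA. Qed.

Lemma second_momentE A : measurable A ->
  second_moment P Z A = 'E (fun w => \1_A w * regr P Z A (Z w)).
Proof. by move=> mA; rewrite -expect_regrM//; exact: bmfun_regr. Qed.

Lemma dist_indic_regr A : measurable A ->
  'E (fun w => (\1_A w - regr P Z A (Z w)) ^+ 2) = prob A - second_moment P Z A.
Proof.
move=> mA; rewrite expect_sqrB; [|exact: bmfun_indic|exact: regr_comp_bmfun].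
by rewrite expect_indic_sqr// -second_momentE// -/(second_moment P Z A); ring.
Qed.

Lemma dist_cst_regr A : measurable A ->
  'E (fun w => (regr P Z A (Z w) - prob A) ^+ 2) =
  second_moment P Z A - prob A ^+ 2.
Proof.
move=> mA; rewrite expect_sqrB; [|exact: regr_comp_bmfun|exact: bmfun_cst].
rewrite -/(second_moment P Z A) expect_cst.
under [X in 2 * X]eq_expect do rewrite mulrC.
by rewrite expectZ ?expect_regr//; [ring|exact: regr_comp_bmfun].
Qed.

Lemma second_moment_le A : measurable A -> second_moment P Z A <= prob A.
Proof.
move=> mA; rewrite -subr_ge0 -dist_indic_regr//.
by apply: expect_ge0 => w; exact: sqr_ge0.
Qed.

Lemma second_moment_ge A : measurable A -> prob A ^+ 2 <= second_moment P Z A.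
Proof.
move=> mA; rewrite -subr_ge0 -dist_cst_regr//.
by apply: expect_ge0 => w; exact: sqr_ge0.
Qed.

Lemma second_moment_max A : measurable A -> second_moment P Z A = prob A ->
  {ae P, forall w, \1_A w = regr P Z A (Z w)}.
Proof.
move=> mA h; apply: ae_eq_sqr; [exact: bmfun_indic|exact: regr_comp_bmfun|].
by rewrite dist_indic_regr// h subrr.
Qed.

Lemma second_moment_min A : measurable A ->
  second_moment P Z A = prob A ^+ 2 ->
  {ae P, forall w, regr P Z A (Z w) = prob A}.
Proof.
move=> mA h; apply: ae_eq_sqr; [exact: regr_comp_bmfun|exact: bmfun_cst|].
by rewrite dist_cst_regr// h subrr.
Qed.

(** The difference of the squares is the product of the difference and the sum
   of the two conditional probabilities.  The sum is a function of [Z], so that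
   the difference can be replaced by that of the indicators.  This avoids
   comparing versions of the two conditional probabilities pointwise. *)
Lemma second_moment_lip A B : measurable A -> measurable B -> B `<=` A ->
  `|second_moment P Z A - second_moment P Z B| <= 2 * (prob A - prob B).
Proof.
move=> mA mB BA.
have rA := regr_comp_bmfun P mZ mA; have rB := regr_comp_bmfun P mZ mB.
have iA : bmfun (\1_A : T -> R) := bmfun_indic mA.
have iB : bmfun (\1_B : T -> R) := bmfun_indic mB.
pose k z := regr P Z A z + regr P Z B z.
have bk : bmfun k by apply: bmfunD; exact: bmfun_regr.
have bkZ : bmfun (k \o Z) by exact: bmfun_comp.
have -> : second_moment P Z A - second_moment P Z B =
    'E (fun w => (\1_A w - \1_B w) * k (Z w)).
  have -> : 'E (fun w => (\1_A w - \1_B w) * k (Z w)) =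
      'E (fun w => \1_A w * k (Z w)) - 'E (fun w => \1_B w * k (Z w)).
    rewrite -expectB; [|exact: bmfunM iA bkZ|exact: bmfunM iB bkZ].
    by apply: eq_expect => w; ring.
  have rAk : bmfun (fun w => regr P Z A (Z w) * k (Z w)) := bmfunM rA bkZ.
  have rBk : bmfun (fun w => regr P Z B (Z w) * k (Z w)) := bmfunM rB bkZ.
  have rAA := bmfun_sqr rA; have rBB := bmfun_sqr rB.
  rewrite -!expect_regrM// -!expectB//.
  by apply: eq_expect => w; rewrite /k; ring.
have AB w : 0 <= \1_A w - \1_B w :> R.
  rewrite !indicE subr_ge0 ler_nat; case: (boolP (w \in B)) => //.
  by rewrite !inE => /BA /mem_set ->.
have k02 z : 0 <= k z <= 2.
  have [_ /(_ z)/andP[a0 a1] _] := regrP P mZ mA.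
  have [_ /(_ z)/andP[b0 b1] _] := regrP P mZ mB.
  by rewrite /k addr_ge0//= -[leRHS]/(1 + 1) lerD.
have bAB := bmfunB iA iB.
rewrite ger0_norm; last first.
  by apply: expect_ge0 => w; rewrite mulr_ge0//; have /andP[] := k02 (Z w).
rewrite -!expect_indic// -expectB// -expectZ//.
apply: le_expect; [exact: bmfunM bAB bkZ|exact: bmfunM (bmfun_cst _) bAB|].
by move=> w; rewrite mulrC ler_wpM2r//; have /andP[] := k02 (Z w).
Qed.

End second_moment_theory.

Section coarsening.
Context {d d1 d2} {T : measurableType d} {E1 : measurableType d1}
  {E2 : measurableType d2} {R : realType} (P : probability T R).
Variables (Z : T -> E1) (mZ : measurable_fun setT Z).
Variables (p : E1 -> E2) (mp : measurable_fun setT p).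
Let W := p \o Z.
Implicit Types (A : set T).
Local Notation "'E f" := (expect P f) (at level 10, f at level 8).

Let mW : measurable_fun setT W. Proof. exact: measurableT_comp. Qed.

(** The mixed term is the second moment for [W], since the conditional
   probability given [W] is a function of [Z] and a legitimate test function
   for the one given [Z]. *)
Lemma dist_regr_coarsening A : measurable A ->
  'E (fun w => (regr P Z A (Z w) - regr P W A (W w)) ^+ 2) =
  second_moment P Z A - second_moment P W A.
Proof.
move=> mA; rewrite expect_sqrB; [|exact: regr_comp_bmfun..].
have -> : 'E (fun w => regr P Z A (Z w) * regr P W A (W w)) = second_moment P W A.
  rewrite (second_momentE P mW mA).
  exact: (expect_regrM P mZ mA (bmfun_comp mp (bmfun_regr P mW mA))).
by rewrite -!/(second_moment _ _ _); ring.
Qed.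

Lemma second_moment_coarsening A : measurable A ->
  second_moment P W A <= second_moment P Z A.
Proof.
move=> mA; rewrite -subr_ge0 -dist_regr_coarsening//.
by apply: expect_ge0 => w; exact: sqr_ge0.
Qed.

Lemma eq_second_moment_coarsening A : measurable A ->
  second_moment P Z A = second_moment P W A <->
  {ae P, forall w, regr P Z A (Z w) = regr P W A (W w)}.
Proof.
move=> mA; split => [h|h].
  apply: ae_eq_sqr; [exact: regr_comp_bmfun..|].
  by rewrite dist_regr_coarsening// h subrr.
apply: ae_eq_expect; [exact/bmfun_sqr/regr_comp_bmfun..|].
by apply: filterS h => w ->.
Qed.

End coarsening.

(** * Functions controlled by a continuous distribution function *)

Section continuous_distribution_function.
Context {d} {T : measurableType d} {R : realType} (P : probability T R).
Variables (Y : {RV P >-> R}) (cY : continuous (cdf Y)).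

Definition rcdf (y : R) : R := fine (cdf Y y).

Lemma EFin_rcdf y : (rcdf y)%:E = cdf Y y.
Proof. by rewrite fineK// fin_num_measure. Qed.

Lemma rcdf_nd x y : x <= y -> rcdf x <= rcdf y.
Proof. by move=> xy; rewrite -lee_fin !EFin_rcdf cdf_nondecreasing. Qed.

Lemma rcdf_ge0 y : 0 <= rcdf y.
Proof. by rewrite -lee_fin EFin_rcdf cdf_ge0. Qed.

Lemma rcdf_le1 y : rcdf y <= 1.
Proof. by rewrite -lee_fin EFin_rcdf cdf_le1. Qed.

Lemma rcdf_continuous : continuous rcdf.
Proof. by move=> y; apply: fine_cvg; rewrite EFin_rcdf; exact: cY. Qed.

Lemma rcdf_surj t : 0 < t < 1 -> exists y, rcdf y = t.
Proof.
move=> /andP[t0 t1].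
have [a at_] : exists a, rcdf a < t.
  have /fine_cvg/cvgr_lt/(_ _ t0)[M [_ Mt]] := @cvg_cdfNy0 _ _ _ P Y.
  by exists (M - 1); apply: Mt; rewrite ltrBlDr ltrDl.
have [b tb] : exists b, t < rcdf b.
  have /fine_cvg/cvgr_gt/(_ _ t1)[M [_ Mt]] := @cvg_cdfy1 _ _ _ P Y.
  by exists (M + 1); apply: Mt; rewrite ltrDl.
have ab : a <= b.
  by rewrite leNgt; apply/negP => /ltW/rcdf_nd; rewrite leNgt (lt_trans at_ tb).
have cF : {within `[a, b], continuous rcdf}.
  exact/continuous_subspaceT/rcdf_continuous.
have abt : Num.min (rcdf a) (rcdf b) <= t <= Num.max (rcdf a) (rcdf b).
  by rewrite ge_min (ltW at_) le_max (ltW tb) orbT.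
by have [c _ ct] := IVT ab cF abt; exists c.
Qed.

(** Lipschitz continuity for the pseudometric that the distribution function
   induces on the line: the regularity in the threshold [y] of the moments of
   [P (Y >= y | Z)], for whatever [Z]. *)
Definition cdf_lipschitz (phi : R -> R) : Prop :=
  exists K : R, forall x y, x <= y -> `|phi x - phi y| <= K * (rcdf y - rcdf x).

Lemma cdf_lipschitz_sym (phi : R -> R) : cdf_lipschitz phi ->
  exists2 K, 0 < K & forall x y, `|phi x - phi y| <= K * `|rcdf x - rcdf y|.
Proof.
move=> [K HK]; exists (`|K| + 1); first by rewrite ltr_pwDr.
have H x y : x <= y -> `|phi x - phi y| <= (`|K| + 1) * `|rcdf x - rcdf y|.
  move=> xy; have F0 : 0 <= rcdf y - rcdf x by rewrite subr_ge0 rcdf_nd.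
  rewrite (le_trans (HK _ _ xy))// distrC (ger0_norm F0) ler_wpM2r//.
  by rewrite (le_trans (ler_norm _))// lerDl.
move=> x y; have [|/ltW] := leP x y; first exact: H.
by move=> /H; rewrite distrC (distrC (rcdf y)).
Qed.

Lemma cdf_lipschitz_bmfun phi : cdf_lipschitz phi -> bmfun phi.
Proof.
move=> /cdf_lipschitz_sym[K K0 HK]; split.
  apply: continuous_measurable_fun => y.
  apply/cvgrPdist_lt => e e0.
  have eK : 0 < e / K by rewrite divr_gt0.
  have := @rcdf_continuous y; move=> /cvgrPdist_lt/(_ _ eK).
  apply: filterS => z yz.
  by rewrite (le_lt_trans (HK _ _))// mulrC -ltr_pdivlMr.
exists (`|phi 0| + K) => y.
rewrite -[phi y](subrK (phi 0)) (le_trans (ler_normD _ _))// addrC lerD2l.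
rewrite (le_trans (HK _ _))// ler_piMr ?(ltW K0)// ler_norml.
have := (rcdf_ge0 y, rcdf_le1 y, rcdf_ge0 0, rcdf_le1 0).
move=> [[[? ?] ?] ?]; apply/andP; split; lra.
Qed.

Lemma cdf_lipschitzB phi psi : cdf_lipschitz phi -> cdf_lipschitz psi ->
  cdf_lipschitz (fun y => phi y - psi y).
Proof.
move=> [K HK] [L HL]; exists (K + L) => x y xy; rewrite mulrDl.
rewrite (_ : _ - _ = (phi x - phi y) - (psi x - psi y)); last by ring.
by rewrite (le_trans (ler_normB _ _))// lerD// ?HK ?HL.
Qed.

Lemma cdf_lipschitz_sqr phi : (forall y, 0 <= phi y <= 1) ->
  cdf_lipschitz phi -> cdf_lipschitz (fun y => phi y ^+ 2).
Proof.
move=> p01 [K HK]; exists (2 * K) => x y xy.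
have /andP[x0 x1] := p01 x; have /andP[y0 y1] := p01 y.
rewrite subr_sqr normrM mulrC -mulrA ler_pM// ?HK// ger0_norm ?addr_ge0//.
by rewrite -[leRHS]/(1 + 1) lerD.
Qed.

Local Notation law := (distribution P Y : probability R R).

(** If [phi] were positive at [y0], it would be positive at all points where the
   distribution function is close enough to its value at [y0].  These include a
   left-open interval on which the distribution function increases, hence a set
   of positive probability. *)
Lemma expect_law_eq0 phi : cdf_lipschitz phi -> (forall y, 0 <= phi y) ->
  expect law phi = 0 -> forall y, phi y = 0.
Proof.
move=> lphi phi0 Ephi y0; apply/eqP/negPn/negP => phiy0.
have [K K0 HK] := cdf_lipschitz_sym lphi.
have c0 : 0 < phi y0 by rewrite lt_neqAle eq_sym phiy0 phi0.
pose e := phi y0 / K.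
have e0 : 0 < e by rewrite divr_gt0.
(* Any two values strictly between m and M are attained, since m and M are
   within [0, 1]. *)
pose m := Num.max 0 (rcdf y0 - e); pose M := Num.min 1 (rcdf y0 + e).
have [F0 F1] := (rcdf_ge0 y0, rcdf_le1 y0).
have mM : m < M.
  by rewrite /m /M gt_max !lt_min ltr01/=; apply/and3P; split; lra.
have m0 : 0 <= m by rewrite le_max lexx.
have me : rcdf y0 - e <= m by rewrite le_max lexx orbT.
have M1 : M <= 1 by rewrite ge_min lexx.
have Me : M <= rcdf y0 + e by rewrite ge_min lexx orbT.
have [a Fa] : exists a, rcdf a = (2 * m + M) / 3.
  by apply: rcdf_surj; apply/andP; split; lra.
have [b Fb] : exists b, rcdf b = (m + 2 * M) / 3.
  by apply: rcdf_surj; apply/andP; split; lra.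
have ab : rcdf a < rcdf b by rewrite Fa Fb; lra.
have ltab : a < b by rewrite ltNge; apply/negP => /rcdf_nd; rewrite leNgt ab.
have phi_gt0 y : a < y <= b -> 0 < phi y.
  move=> /andP[/ltW/rcdf_nd ay /rcdf_nd yb].
  have : `|phi y0 - phi y| < phi y0.
    rewrite (le_lt_trans (HK _ _))// -ltr_pdivlMl// mulrC -/e.
    by rewrite ltr_norml; apply/andP; split; lra.
  by rewrite ltr_norml => /andP[_]; lra.
have [N [mN N0 phiN]] := expect_eq0 (cdf_lipschitz_bmfun lphi) phi0 Ephi.
have abN : `]a, b] `<=` N.
  move=> y; rewrite /= in_itv /= => /phi_gt0 py; apply: phiN => /= /eqP.
  by rewrite gt_eqF.
have lab0 : law `]a, b]%classic = 0%E.
  by apply/eqP; rewrite -measure_le0 -N0 le_measure ?inE.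
have : (cdf Y b <= cdf Y a + law `]a, b]%classic)%E.
  rewrite /cdf -measureU//.
  - rewrite le_measure ?inE//; first exact: measurableU.
    by move=> y /=; rewrite !in_itv/=; case: (leP y a); [left|right].
  - by rewrite -subset0 => y [] /=; rewrite !in_itv /= leNgt => /negP ya /andP[].
by rewrite lab0 adde0 -!EFin_rcdf lee_fin leNgt ab.
Qed.

Definition surv (y : R) : R := fine (P [set w | y <= Y w]).

Lemma measurable_ge_event y : measurable [set w | y <= Y w].
Proof.
rewrite (_ : [set w | _] = Y @^-1` `[y, +oo[); first exact: measurable_funPTI.
by apply/seteqP; split => w /=; rewrite in_itv /= andbT.
Qed.

Lemma EFin_surv y : (surv y)%:E = P [set w | y <= Y w].
Proof. by rewrite fineK// fin_num_measure//; exact: measurable_ge_event. Qed.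

(** The distribution function is continuous, so [Y] has no atom at [y]: the
   probability of [Y >= y] is at most that of [Y > x] for [x] just below [y]. *)
Lemma survE y : surv y = 1 - rcdf y.
Proof.
have le1 x : x < y -> surv y <= 1 - rcdf x.
  move=> xy; rewrite -lee_fin EFin_surv.
  rewrite EFinB EFin_rcdf -ccdf_1_cdf /ccdf /distribution /pushforward.
  apply: le_measure; rewrite ?inE.
  + exact: measurable_ge_event.
  + exact: measurable_funPTI.
  + by move=> w /= yw; rewrite in_itv /= andbT (lt_le_trans xy).
apply/eqP; rewrite eq_le; apply/andP; split; last first.
  rewrite -lee_fin EFin_surv.
  rewrite EFinB EFin_rcdf -ccdf_1_cdf /ccdf /distribution /pushforward.
  apply: le_measure; rewrite ?inE.
  + exact: measurable_funPTI.
  + exact: measurable_ge_event.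
  + by move=> w /=; rewrite in_itv /= andbT => /ltW.
apply/ler_addgt0Pr => e e0.
have /cvgrPdist_lt/(_ _ e0)[/= r r0 Fr] := @rcdf_continuous y.
have r20 : 0 < r / 2 by rewrite divr_gt0.
have : `|rcdf y - rcdf (y - r / 2)| < e.
  apply: Fr => /=; rewrite opprB addrC subrK gtr0_norm// ltr_pdivrMr//.
  by rewrite ltr_pMr// ltr1n.
rewrite ltr_norml => /andP[_ ?].
by have := @le1 (y - r / 2); rewrite ltrBlDr ltrDl => /(_ r20); lra.
Qed.

Lemma surv01 y : 0 <= surv y <= 1.
Proof. by rewrite survE subr_ge0 rcdf_le1 lerBlDr lerDl rcdf_ge0. Qed.

Lemma surv_lipschitz : cdf_lipschitz surv.
Proof.
exists 1 => x y xy; rewrite !survE mul1r.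
rewrite [X in `|X|](_ : _ = rcdf y - rcdf x); last by ring.
by rewrite ger0_norm// subr_ge0 rcdf_nd.
Qed.

End continuous_distribution_function.

(** * The dependence measure and its cases of equality *)

Section dependence_measure.
Context {d} {T : measurableType d} {R : realType} (P : probability T R).
Variables (Y : {RV P >-> R}) (cY : continuous (cdf Y)).
Local Notation law := (distribution P Y : probability R R).

Definition ge_moment {d'} {E : measurableType d'} (Z : T -> E) (y : R) : R :=
  second_moment P Z [set w | y <= Y w].

Lemma ge_moment_lipschitz {d'} {E : measurableType d'} (Z : T -> E) :
  measurable_fun setT Z -> cdf_lipschitz Y (ge_moment Z).
Proof.
move=> mZ; exists 2 => x y xy.
have -> : rcdf Y y - rcdf Y x = surv Y x - surv Y y by rewrite !survE//; ring.
apply: second_moment_lip => //; [exact: measurable_ge_event..|].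
by move=> w /=; exact: le_trans.
Qed.

Lemma surv_sqr_lipschitz : cdf_lipschitz Y (fun y => surv Y y ^+ 2).
Proof.
apply: cdf_lipschitz_sqr; last exact: surv_lipschitz.
by move=> y; exact: surv01.
Qed.

Definition Tnum {d'} {E : measurableType d'} (Z : T -> E) : R :=
  expect law (fun y => ge_moment Z y - surv Y y ^+ 2).

Definition Tden : R := expect law (fun y => surv Y y - surv Y y ^+ 2).

Lemma variance_indic_ge y :
  ('V_P[\1_[set w | (y <= Y w)%R]] = (surv Y y - surv Y y ^+ 2)%:E)%E.
Proof.
have mA := measurable_ge_event Y y.
by rewrite variance_bmfun ?expect_indic_sqr ?expect_indic//; exact: bmfun_indic.
Qed.

Lemma TdepE {d'} {E : measurableType d'} (Z : T -> E) :
  measurable_fun setT Z -> Tdep Y Z = Tnum Z / Tden.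
Proof.
move=> mZ; rewrite /Tdep /Tnum /Tden /expect /Rintegral.
congr (fine _ / fine _).
- apply: eq_integral => y _; rewrite variance_cond_prob//.
  exact: measurable_ge_event.
- by apply: eq_integral => y _; exact: variance_indic_ge.
Qed.

(** Otherwise the distribution function would only take the values 0 and 1. *)
Lemma Tden_gt0 : 0 < Tden.
Proof.
have ge0 y : 0 <= surv Y y - surv Y y ^+ 2.
  have /andP[s0 s1] := surv01 cY y.
  by rewrite expr2 -[X in X - _]mulr1 -mulrBr mulr_ge0// subr_ge0.
rewrite lt_neqAle expect_ge0// andbT eq_sym; apply/eqP => Tden0.
have half : 0 < (2^-1 : R) < 1 by apply/andP; split; lra.
have [y Fy] := rcdf_surj cY half.
have lip := cdf_lipschitzB (surv_lipschitz cY) surv_sqr_lipschitz.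
have := expect_law_eq0 cY lip ge0 Tden0 y.
rewrite survE// Fy; lra.
Qed.

Lemma Tnum_diff {d1 d2} {E1 : measurableType d1} {E2 : measurableType d2}
    (Z : T -> E1) (W : T -> E2) :
  measurable_fun setT Z -> measurable_fun setT W ->
  Tnum Z - Tnum W = expect law (fun y => ge_moment Z y - ge_moment W y).
Proof.
move=> mZ mW; rewrite -expectB.
- by apply: eq_expect => y; ring.
- apply: (cdf_lipschitz_bmfun cY); apply: cdf_lipschitzB.
    exact: ge_moment_lipschitz.
  exact: surv_sqr_lipschitz.
- apply: (cdf_lipschitz_bmfun cY); apply: cdf_lipschitzB.
    exact: ge_moment_lipschitz.
  exact: surv_sqr_lipschitz.
Qed.

Lemma Tdep_eq1 {d'} {E : measurableType d'} (Z : T -> E) :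
  measurable_fun setT Z -> Tdep Y Z = 1 <-> forall y, ge_moment Z y = surv Y y.
Proof.
move=> mZ; have D0 : Tden != 0 by rewrite gt_eqF// Tden_gt0.
have lM := ge_moment_lipschitz mZ; have lS := surv_lipschitz cY.
have lS2 := surv_sqr_lipschitz.
rewrite TdepE//; split => [T1|h].
  have ND : Tnum Z = Tden by rewrite -(divfK D0 (Tnum Z)) T1 mul1r.
  have d0 : expect law (fun y => surv Y y - ge_moment Z y) = 0.
    transitivity (Tden - Tnum Z); last by rewrite ND subrr.
    rewrite -expectB; first by apply: eq_expect => y; ring.
      by apply: (cdf_lipschitz_bmfun cY); exact: (cdf_lipschitzB lS lS2).
    by apply: (cdf_lipschitz_bmfun cY); exact: (cdf_lipschitzB lM lS2).
  move=> y; apply/esym/eqP; rewrite -subr_eq0; apply/eqP; move: y.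
  apply: (expect_law_eq0 cY (cdf_lipschitzB lS lM)) => // y.
  by rewrite subr_ge0; apply: second_moment_le => //; exact: measurable_ge_event.
rewrite (_ : Tnum Z = Tden) ?divff//.
by apply: eq_expect => y; rewrite h.
Qed.

Lemma Tdep_eq0 {d'} {E : measurableType d'} (Z : T -> E) :
  measurable_fun setT Z ->
  Tdep Y Z = 0 <-> forall y, ge_moment Z y = surv Y y ^+ 2.
Proof.
move=> mZ; have D0 : Tden != 0 by rewrite gt_eqF// Tden_gt0.
have lM := ge_moment_lipschitz mZ; have lS2 := surv_sqr_lipschitz.
rewrite TdepE//; split => [T0|h].
  have N0 : Tnum Z = 0 by rewrite -(divfK D0 (Tnum Z)) T0 mul0r.
  move=> y; apply/eqP; rewrite -subr_eq0; apply/eqP; move: y.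
  apply: (expect_law_eq0 cY (cdf_lipschitzB lM lS2)) => // y.
  by rewrite subr_ge0; apply: second_moment_ge => //; exact: measurable_ge_event.
rewrite (_ : Tnum Z = 0) ?mul0r//.
by rewrite /Tnum; under eq_expect do rewrite h subrr; rewrite expect_cst.
Qed.

Section coarser_explanatory_variable.
Context {d1 d2} {E1 : measurableType d1} {E2 : measurableType d2}.
Variables (Z : T -> E1) (mZ : measurable_fun setT Z).
Variables (p : E1 -> E2) (mp : measurable_fun setT p).
Let W := p \o Z.
Let mW : measurable_fun setT W. Proof. exact: measurableT_comp. Qed.

Let diff_ge0 y : 0 <= ge_moment Z y - ge_moment W y.
Proof.
rewrite subr_ge0; apply: second_moment_coarsening => //.
exact: measurable_ge_event.
Qed.

Lemma Tdep_coarsening : Tdep Y W <= Tdep Y Z.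
Proof.
rewrite !TdepE// ler_pM2r ?invr_gt0 ?Tden_gt0// -subr_ge0 Tnum_diff//.
exact: expect_ge0.
Qed.

Lemma eq_Tdep_coarsening :
  Tdep Y Z = Tdep Y W <->
  forall y, {ae P, forall w, regr P Z [set w | y <= Y w] (Z w) =
                             regr P W [set w | y <= Y w] (W w)}.
Proof.
have D0 : Tden^-1 != 0 by rewrite invr_eq0 gt_eqF// Tden_gt0.
have mA y := measurable_ge_event Y y.
rewrite !TdepE//; split => [/(mulIf D0) NN y|h].
  apply/(eq_second_moment_coarsening P mZ mp) => //.
  apply/eqP; rewrite -subr_eq0; apply/eqP; move: y.
  apply: (expect_law_eq0 cY) diff_ge0 _.
    by apply: cdf_lipschitzB; exact: ge_moment_lipschitz.
  by rewrite -Tnum_diff// NN subrr.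
congr (_ / _); apply: eq_expect => y; congr (_ - _).
by apply/(eq_second_moment_coarsening P mZ mp).
Qed.

End coarser_explanatory_variable.

(** The choice of a version depends only on the set of all versions, so that
   the two sides are built from the same functions. *)
Lemma Tdep_eq_sigma {d1 d2} {E1 : measurableType d1} {E2 : measurableType d2}
    (Z : T -> E1) (W : T -> E2) :
  g_sigma_algebra_preimage Z = g_sigma_algebra_preimage W ->
  Tdep Y Z = Tdep Y W.
Proof.
move=> ZW; have cZW A : cond_prob P Z A = cond_prob P W A.
  congr (xget _ _); apply/funext => g; apply/propext.
  by rewrite /is_cond_prob ZW.
by rewrite /Tdep; under eq_integral do rewrite cZW.
Qed.

End dependence_measure.

(** * Complete dependence *)

Lemma probability_ae {d} {T : measurableType d} {R : realType}
    (P : probability T R) (D : set T) : measurable D ->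
  P D = 1%E <-> {ae P, forall w, D w}.
Proof.
move=> mD; have H := probability_setC P mD; split => [PD|[N [mN N0 DN]]].
  exists (~` D); split => //; first exact: measurableC.
  by rewrite H PD subee.
have : P (~` D) = 0%E.
  by apply/eqP; rewrite -measure_le0 -N0 le_measure// inE//; exact: measurableC.
rewrite H -(fineK (fin_num_measure P _ mD)) -EFinB => -[D0].
by congr EFin; lra.
Qed.

Section complete_dependence.
Context {d d'} {T : measurableType d} {E : measurableType d'} {R : realType}
  (P : probability T R).
Variables (Y : {RV P >-> R}) (Z : T -> E) (mZ : measurable_fun setT Z).
Local Notation "'E f" := (expect P f) (at level 10, f at level 8).

Lemma measurable_eq_event (f : E -> R) : measurable_fun setT f ->
  measurable [set w | Y w = f (Z w)].
Proof.
move=> mf; have mfZ : measurable_fun setT (f \o Z) by exact: measurableT_comp.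
rewrite (_ : [set w | _] = (fun w => Y w - f (Z w)) @^-1` [set 0]).
  by apply: measurable_preimage => //; apply: measurable_funB.
by apply/seteqP; split => w /= /eqP; [rewrite -subr_eq0|rewrite subr_eq0] => /eqP.
Qed.

(** The event [Y >= y] is almost surely the event [f (Z) >= y], whose indicator
   is a test function for the conditional probability given [Z]. *)
Lemma completely_dependent_ge_moment : completely_dependent P Y Z ->
  forall y, ge_moment Y Z y = surv Y y.
Proof.
move=> [f [mf PYf]] y.
have mA := measurable_ge_event Y y; set A := [set w | _] in mA.
have YfZ : {ae P, forall w, Y w = f (Z w)}.
  by apply/(probability_ae _ (measurable_eq_event mf)).
pose B := f @^-1` `[y, +oo[.
have mB : measurable B by exact: measurable_preimage.
have AB : {ae P, forall w, \1_A w = \1_B (Z w) :> R}.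
  apply: filterS YfZ => w Yw; rewrite !indicE; congr (nat_of_bool _)%:R.
  by apply/idP/idP; rewrite !inE /A /B /= in_itv /= andbT Yw.
have bA : bmfun (\1_A : T -> R) := bmfun_indic mA.
have bB : bmfun (\1_B : E -> R) := bmfun_indic mB.
have bBZ : bmfun (fun w => \1_B (Z w) : R) := bmfun_comp mZ bB.
have rA := regr_comp_bmfun P mZ mA.
rewrite /ge_moment -/A (second_momentE P mZ mA).
transitivity ('E (fun w => regr P Z A (Z w) * \1_B (Z w))).
  apply: ae_eq_expect; [exact: (bmfunM bA rA)|exact: (bmfunM rA bBZ)|].
  by apply: filterS AB => w ->; rewrite mulrC.
rewrite expect_regrM// /surv -/A -(expect_indic_sqr P mA).
apply: ae_eq_expect; [exact: (bmfunM bA bBZ)|exact: (bmfunM bA bA)|].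
by apply: filterS AB => w <-.
Qed.

(** Almost surely, [regr] is 1 for exactly those rational thresholds that are at
   most [Y], and [Y] is their supremum. *)
Lemma ge_moment_completely_dependent :
  (forall y, ge_moment Y Z y = surv Y y) -> completely_dependent P Y Z.
Proof.
move=> h.
(* An enumeration of the rationals; the default 0 is one of them. *)
pose q n : R := ratr (odflt 0%Q (unpickle n)).
pose A n := [set w | q n <= Y w].
have mA n : measurable (A n) by exact: measurable_ge_event.
pose g n z : \bar R := if regr P Z (A n) z == 1 then (q n)%:E else -oo%E.
have mg n : measurable_fun setT (g n).
  have [mr _ _] := regrP P mZ (mA n).
  by apply: measurable_fun_ifT => //; exact: measurable_fun_eqr.
(* The supremum is taken in the extended reals, where it always exists; off a
   null set it is the real number Y. *)
pose f z := fine (esups (g ^~ z) 0).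
have mf : measurable_fun setT f.
  by apply: measurableT_comp => //; exact: measurable_fun_esups.
have AZ : {ae P, forall w, forall n, \1_(A n) w = regr P Z (A n) (Z w)}.
  by apply/ae_foralln => n; apply: second_moment_max => //; exact: h.
have YfZ : {ae P, forall w, Y w = f (Z w)}.
  apply: filterS AZ => w Aw.
  suff -> : f (Z w) = fine (Y w)%:E by [].
  congr fine; rewrite /esups /sdrop.
  apply/eqP; rewrite eq_le; apply/andP; split.
    apply: ge_ereal_sup => _ [n _ <-]; rewrite /g -Aw indicE.
    case: (boolP (w \in A n)) => [|_].
      by rewrite inE eqxx lee_fin.
    by rewrite eq_sym oner_eq0 leNye.
  apply/lee_subgt0Pr => e e0.
  have /rat_in_itvoo[r] : Y w - e < Y w by rewrite ltrBlDr ltrDl.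
  rewrite in_itv /= => /andP[er rY].
  apply: (@le_trans _ _ (ratr r)%:E); first by rewrite -EFinB lee_fin ltW.
  apply: ereal_sup_ubound; exists (pickle r) => //.
  rewrite /g -Aw /A /q pickleK /= indicE mem_set ?eqxx//=.
  exact: ltW.
by exists f; split => //; apply/probability_ae => //; exact: measurable_eq_event.
Qed.

End complete_dependence.

(** * Independence *)

Section pi_lambda.
Context {d d'} {T : measurableType d} {E : measurableType d'} {R : realType}
  (P : probability T R).
Local Notation "'E f" := (expect P f) (at level 10, f at level 8).

(** The sets [B] that satisfy the conclusion form a Dynkin system. *)
Lemma expect_pi_lambda (V : T -> E) (G : set (set E)) (h k : T -> R) :
  measurable_fun setT V -> @measurable _ E = <<s G >> -> setI_closed G ->
  bmfun h -> bmfun k -> 'E h = 'E k ->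
  (forall B, G B ->
    'E (fun w => h w * \1_B (V w)) = 'E (fun w => k w * \1_B (V w))) ->
  forall B, measurable B ->
    'E (fun w => h w * \1_B (V w)) = 'E (fun w => k w * \1_B (V w)).
Proof.
move=> mV GE GI bh bk hk hkG.
have mVB B : measurable B -> measurable (V @^-1` B).
  exact: measurable_preimage.
have b1 B : measurable B -> bmfun (fun w => \1_B (V w) : R).
  by move=> mB; apply: (bmfun_comp mV); exact: bmfun_indic.
have EB f B : measurable B -> bmfun f ->
    (('E (fun w => f w * \1_B (V w)))%:E = \int[P]_(w in V @^-1` B) (f w)%:E)%E.
  move=> mB bf; rewrite expect_indicM; last exact: mVB.
  by rewrite -EFin_expect//; exact: (bmfunM bf (b1 _ mB)).
move=> B mB; rewrite GE in mB; move: B mB.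
apply: (dynkin_induction GE GI) => //.
- have ET f : 'E (fun w => f w * \1_[set: E] (V w)) = 'E f.
    by apply: eq_expect => w; rewrite indicT mulr1.
  by rewrite !ET.
- move=> B mB hkB.
  have EC f : bmfun f -> 'E (fun w => f w * \1_(~` B) (V w)) =
      'E f - 'E (fun w => f w * \1_B (V w)).
    move=> bf; rewrite -expectB//; last exact: (bmfunM bf (b1 _ mB)).
    apply: eq_expect => w; rewrite !indicE in_setC.
    by case: (V w \in B); rewrite /= ?mulr1 ?mulr0 ?subr0 ?subrr.
  by rewrite !EC// hk hkB.
- move=> F mF tF hkF; apply: EFin_inj.
  have mUF : measurable (\bigcup_k F k) by exact: bigcupT_measurable.
  have tVF : trivIset setT (fun n => V @^-1` F n).
    by move=> i j _ _ [w [Fi Fj]]; apply: tF => //; exists (V w).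
  have iF f : bmfun f -> (\int[P]_(w in \bigcup_n (V @^-1` F n)) (f w)%:E =
      \sum_(n <oo) \int[P]_(w in V @^-1` F n) (f w)%:E)%E.
    move=> bf; apply: integral_bigcup => //; first by move=> n; exact: mVB.
    by apply: bmfun_integrable => //; apply: bigcupT_measurable => n; exact: mVB.
  rewrite !EB// !preimage_bigcup !iF//.
  by apply: eq_eseriesr => n _; rewrite -!EB// hkF.
Qed.

End pi_lambda.

Lemma expect_rays_pi_lambda {d} {T : measurableType d} {R : realType}
    (P : probability T R) (Y : {RV P >-> R}) (h k : T -> R) :
  bmfun h -> bmfun k -> expect P h = expect P k ->
  (forall y, expect P (fun w => h w * \1_[set w | y <= Y w] w) =
             expect P (fun w => k w * \1_[set w | y <= Y w] w)) ->
  forall B : set R, measurable B ->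
    expect P (fun w => h w * \1_(Y @^-1` B) w) =
    expect P (fun w => k w * \1_(Y @^-1` B) w).
Proof.
move=> bh bk hk hkY B mB.
have mY : measurable_fun setT Y by [].
have GI : setI_closed (@RGenCInfty.G R).
  move=> _ _ [x ->] [y ->]; exists (Num.max x y).
  by apply/seteqP; split => z /=; rewrite !in_itv/= !andbT ge_max => /andP.
have rays C : @RGenCInfty.G R C -> expect P (fun w => h w * \1_C (Y w)) =
    expect P (fun w => k w * \1_C (Y w)).
  move=> [y ->].
  have e (f : T -> R) : (fun w => f w * \1_(`[y, +oo[%classic) (Y w)) =
      (fun w => f w * \1_[set w | y <= Y w] w).
    apply/funext => w; congr (_ * _); rewrite !indicE; congr (nat_of_bool _)%:R.
    by apply/idP/idP; rewrite !inE /= in_itv/= andbT.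
  by rewrite !e.
exact: (expect_pi_lambda mY (RGenCInfty.measurableE R) GI bh bk hk rays mB).
Qed.

Section independence.
Context {d d'} {T : measurableType d} {E : measurableType d'} {R : realType}
  (P : probability T R).
Variables (Y : {RV P >-> R}) (Z : T -> E) (mZ : measurable_fun setT Z).
Local Notation "'E f" := (expect P f) (at level 10, f at level 8).

(** With [h] the indicator of [Z in B] and [k] its expectation, the assumption
   says that both have the same integral on the events [Y >= y]. *)
Lemma ge_moment_independent :
  (forall y, ge_moment Y Z y = surv Y y ^+ 2) -> independent_rv P Y Z.
Proof.
move=> h A B mA mB.
have mYA : measurable (Y @^-1` A) by exact: measurable_funPTI.
have mZB : measurable (Z @^-1` B) by exact: measurable_preimage.
have bB : bmfun (\1_(Z @^-1` B) : T -> R) := bmfun_indic mZB.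
set c := fine (P (Z @^-1` B)).
have -> : P (Y @^-1` A `&` Z @^-1` B) =
    ('E (fun w => \1_(Z @^-1` B) w * \1_(Y @^-1` A) w))%:E.
  rewrite -(fineK (fin_num_measure P _ (measurableI _ _ mYA mZB))).
  rewrite -expect_indic; last exact: measurableI.
  by rewrite indicI; congr EFin; apply: eq_expect => w; rewrite /= mulrC.
rewrite (@expect_rays_pi_lambda _ _ _ _ Y _ (fun _ => c))//.
- rewrite expectZ ?expect_indic//; last exact: bmfun_indic.
  by rewrite mulrC EFinM !fineK ?fin_num_measure.
- exact: bmfun_cst.
- by rewrite expect_cst expect_indic.
- move=> y; have mAy := measurable_ge_event Y y.
  have bAy : bmfun (\1_[set w | y <= Y w] : T -> R) := bmfun_indic mAy.
  have bB' : bmfun (\1_B : E -> R) := bmfun_indic mB.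
  rewrite expectZ// expect_indic//.
  transitivity ('E (fun w => \1_[set w | y <= Y w] w * \1_B (Z w))).
    by apply: eq_expect => w; rewrite mulrC.
  rewrite -(expect_regrM P mZ mAy)//.
  transitivity ('E (fun w => surv Y y * \1_(Z @^-1` B) w)).
    apply: ae_eq_expect.
    + exact: (bmfunM (regr_comp_bmfun P mZ mAy) (bmfun_comp mZ bB')).
    + exact: (bmfunM (bmfun_cst _) bB).
    + by apply: filterS (second_moment_min mZ mAy (h y)) => w ->.
  by rewrite expectZ// expect_indic// mulrC.
Qed.

(** Under independence the constant [P (Y >= y)] is a version. *)
Lemma independent_ge_moment : independent_rv P Y Z ->
  forall y, ge_moment Y Z y = surv Y y ^+ 2.
Proof.
move=> YZ y; have mA := measurable_ge_event Y y.
rewrite /ge_moment; set A := [set w | _] in mA *.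
have AE : A = Y @^-1` `[y, +oo[.
  by apply/seteqP; split => w; rewrite /A /= in_itv /= andbT.
have c1 : is_cond_prob P Z A ((fun _ => surv Y y) \o Z).
  apply: is_cond_prob_comp => //; first exact: bmfun_cst.
  move=> B mB.
  have mZB : measurable (Z @^-1` B) by exact: measurable_preimage.
  have bB : bmfun (\1_(Z @^-1` B) : T -> R) := bmfun_indic mZB.
  rewrite expectZ// expect_indic//.
  transitivity ('E \1_(A `&` Z @^-1` B)); last by rewrite indicI.
  rewrite expect_indic; last exact: measurableI.
  by rewrite AE YZ// fineM ?fin_num_measure -?AE.
have := is_cond_prob_ae_eq mZ mA c1 (is_cond_prob_regr P mZ mA).
move=> cr; rewrite -(expect_cst P (surv Y y ^+ 2)).
apply: ae_eq_expect.
- exact: bmfun_sqr (regr_comp_bmfun P mZ mA).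
- exact: bmfun_cst.
- by apply: filterS cr => w /= <-.
Qed.

End independence.

(** * Conditional independence *)

(** The pi-system of rectangles, seen through the map [(p, q)] without forming a
   product space. *)
Definition preimage_pairs {d d1 d2} {E : measurableType d}
    {E1 : measurableType d1} {E2 : measurableType d2}
    (p : E -> E1) (q : E -> E2) : set (set E) :=
  [set D | exists C B, [/\ measurable C, measurable B &
                           D = p @^-1` C `&` q @^-1` B]].

Section conditional_independence.
Context {d d' d1 d2} {T : measurableType d} {E : measurableType d'}
  {E1 : measurableType d1} {E2 : measurableType d2} {R : realType}
  (P : probability T R).
Variables (Y : {RV P >-> R}) (Z : T -> E) (mZ : measurable_fun setT Z).
Variables (p : E -> E1) (mp : measurable_fun setT p).
Variables (q : E -> E2) (mq : measurable_fun setT q).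
Let W := p \o Z.
Let V := q \o Z.
Local Notation "'E f" := (expect P f) (at level 10, f at level 8).

Let mW : measurable_fun setT W. Proof. exact: measurableT_comp. Qed.
Let mV : measurable_fun setT V. Proof. exact: measurableT_comp. Qed.

Let mVB B : measurable B -> measurable (V @^-1` B).
Proof. exact: measurable_preimage. Qed.

(** Write [p_A] for a conditional probability given [W].  On a set [W in C],
   the integral of [p_{Y in A} p_{V in B}] is that of [1_{Y in A} p_{V in B}],
   by the defining property of [p_{Y in A}].  For a ray [A], where [p_{Y in A}]
   is also a conditional probability given [Z], it equals that of
   [1_{Y in A} 1_{V in B}]; the rays determine the general case. *)
Lemma regr_cond_independent :
  (forall y, {ae P, forall w, regr P Z [set w | y <= Y w] (Z w) =
                              regr P W [set w | y <= Y w] (W w)}) ->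
  cond_independent_rv P Y V W.
Proof.
move=> h A B mA mB.
have mYA : measurable (Y @^-1` A) by exact: measurable_funPTI.
have mVB' := mVB mB.
have mAB := measurableI _ _ mYA mVB'.
have rA := bmfun_regr P mW mYA.
have rB := bmfun_regr P mW mVB'.
have rAB := bmfunM rA rB.
have cAB : is_cond_prob P W (Y @^-1` A `&` V @^-1` B)
    ((fun z => regr P W (Y @^-1` A) z * regr P W (V @^-1` B) z) \o W).
  apply: is_cond_prob_comp => // C mC.
  have bC : bmfun (\1_C : E1 -> R) := bmfun_indic mC.
  have bBE : bmfun (\1_B : E2 -> R) := bmfun_indic mB.
  have bBV : bmfun (\1_B \o V : T -> R) := bmfun_comp mV bBE.
  have bCW : bmfun (\1_C \o W : T -> R) := bmfun_comp mW bC.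
  have rBC := bmfunM rB bC.
  transitivity ('E (fun w =>
      \1_(Y @^-1` A) w * (regr P W (V @^-1` B) (W w) * \1_C (W w)))).
    rewrite -(expect_regrM P mW mYA rBC).
    by apply: eq_expect => w; rewrite mulrA.
  transitivity ('E (fun w =>
      (regr P W (V @^-1` B) (W w) * \1_C (W w)) * \1_(Y @^-1` A) w)).
    by apply: eq_expect => w; rewrite mulrC.
  transitivity ('E (fun w =>
      (\1_B (V w) * \1_C (W w)) * \1_(Y @^-1` A) w)); last first.
    by apply: eq_expect => w; rewrite indicI /=; ring.
  apply: expect_rays_pi_lambda => //.
  - exact: (bmfun_comp mW rBC).
  - exact: (bmfunM bBV bCW).
  - exact: (expect_regrM P mW mVB' bC).
  move=> y; have mAy := measurable_ge_event Y y.
  set Ay := [set w | _] in mAy *.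
  have bAy : bmfun (\1_Ay : T -> R) := bmfun_indic mAy.
  have rAy := bmfun_regr P mW mAy.
  have rAyC := bmfunM rAy bC.
  transitivity ('E (fun w =>
      \1_Ay w * (regr P W (V @^-1` B) (W w) * \1_C (W w)))).
    by apply: eq_expect => w; rewrite mulrC.
  rewrite -(expect_regrM P mW mAy rBC).
  transitivity ('E (fun w =>
      regr P W (V @^-1` B) (W w) * (regr P W Ay (W w) * \1_C (W w)))).
    by apply: eq_expect => w; ring.
  rewrite (expect_regrM P mW mVB' rAyC).
  have bk : bmfun (fun z : E => \1_B (q z) * \1_C (p z) : R).
    exact: (bmfunM (bmfun_comp mq bBE) (bmfun_comp mp bC)).
  transitivity ('E (fun w => regr P Z Ay (Z w) * (\1_B (V w) * \1_C (W w)))).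
    apply: ae_eq_expect.
    + exact: (bmfunM (bmfun_indic mVB') (bmfun_comp mW rAyC)).
    + exact: (bmfunM (regr_comp_bmfun P mZ mAy) (bmfun_comp mZ bk)).
    + apply: filterS (h y) => w ->; rewrite /= -[\1_(V @^-1` B) w]/(\1_B (V w)).
      by ring.
  rewrite (expect_regrM P mZ mAy bk).
  by apply: eq_expect => w; rewrite mulrC.
have := is_cond_prob_ae_eq mW mAB cAB (cond_probP P mW mAB).
have := cond_prob_regr P mW mYA; have := cond_prob_regr P mW mVB'.
by apply: filterS3 => w -> -> <-.
Qed.

(** The conditional probability of [Y >= y] given [W] has the right integral on
   every set [W in C, V in B]: by conditional independence, averaging the
   indicator of [V in B] given [W] turns the product into the conditional
   probability of the intersection. *)
Lemma cond_independent_regr :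
  @measurable _ E = <<s preimage_pairs p q >> ->
  cond_independent_rv P Y V W ->
  forall y, {ae P, forall w, regr P Z [set w | y <= Y w] (Z w) =
                             regr P W [set w | y <= Y w] (W w)}.
Proof.
move=> mE YVW y.
have mA := measurable_ge_event Y y; set A := [set w | _] in mA *.
have AE : A = Y @^-1` `[y, +oo[.
  by apply/seteqP; split => w; rewrite /A /= in_itv /= andbT.
have rW := bmfun_regr P mW mA.
have rA := bmfun_comp mp rW.
have bA : bmfun (\1_A : T -> R) := bmfun_indic mA.
suff cA : is_cond_prob P Z A ((regr P W A \o p) \o Z).
  exact: (is_cond_prob_ae_eq mZ mA (is_cond_prob_regr P mZ mA) cA).
apply: is_cond_prob_comp => //.
apply: (expect_pi_lambda mZ mE) => //.
- move=> _ _ [C1 [B1 [mC1 mB1 ->]]] [C2 [B2 [mC2 mB2 ->]]].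
  exists (C1 `&` C2), (B1 `&` B2); split; [exact: measurableI..|].
  by rewrite !preimage_setI setIACA.
- exact: (bmfun_comp mZ rA).
- by rewrite expect_indic// -(expect_regr P mW mA).
move=> _ [C [B [mC mB ->]]].
have mVB' := mVB mB; have mAB := measurableI _ _ mA mVB'.
have bC : bmfun (\1_C : E1 -> R) := bmfun_indic mC.
have rWC := bmfunM rW bC.
have rB := bmfun_regr P mW mVB'.
have rAB := bmfun_regr P mW mAB.
transitivity ('E (fun w => \1_(V @^-1` B) w * (regr P W A (W w) * \1_C (W w)))).
  apply: eq_expect => w; rewrite indicI /=.
  rewrite -[\1_(V @^-1` B) w]/(\1_(q @^-1` B) (Z w)).
  rewrite -[\1_C (W w)]/(\1_(p @^-1` C) (Z w)).
  by ring.
rewrite -(expect_regrM P mW mVB' rWC).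
transitivity ('E (fun w => regr P W (A `&` V @^-1` B) (W w) * \1_C (W w))).
  apply: ae_eq_expect.
  - exact: (bmfun_comp mW (bmfunM rB rWC)).
  - exact: (bmfun_comp mW (bmfunM rAB bC)).
  - have mray : measurable `[y, +oo[%classic by exact: measurable_itv.
    have := YVW _ _ mray mB; rewrite -AE => ci.
    have cm := cond_prob_regr P mW mAB.
    have cA := cond_prob_regr P mW mA.
    have cB := cond_prob_regr P mW mVB'.
    have rABE : {ae P, forall w, regr P W (A `&` V @^-1` B) (W w) =
        cond_prob P W A w * cond_prob P W (V @^-1` B) w}.
      by apply: filterS2 ci cm => w <- ->.
    by apply: filterS3 rABE cA cB => w -> -> ->; rewrite mulrA [X in X * _]mulrC.
rewrite (expect_regrM P mW mAB bC).
apply: eq_expect => w; rewrite !indicI /=.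
rewrite -[\1_(V @^-1` B) w]/(\1_(q @^-1` B) (Z w)).
rewrite -[\1_C (W w)]/(\1_(p @^-1` C) (Z w)).
by ring.
Qed.

End conditional_independence.

(** * Sigma-algebras generated by subvectors *)

Section generated_sigma_algebras.
Context {d d1 d2} {T : measurableType d} {E1 : measurableType d1}
  {E2 : measurableType d2}.

Lemma sub_g_sigma_algebra_preimage (Z1 : T -> E1) (Z2 : T -> E2) :
  measurable_fun [set: g_sigma_algebra_preimageType Z2] Z1 ->
  g_sigma_algebra_preimage Z1 `<=` g_sigma_algebra_preimage Z2.
Proof. by move=> mZ _ [B mB <-]; exact: mZ. Qed.

Lemma g_sigma_algebra_preimage_comp (Z : T -> E1) (p : E1 -> E2) :
  measurable_fun setT p ->
  g_sigma_algebra_preimage (p \o Z) `<=` g_sigma_algebra_preimage Z.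
Proof.
move=> mp _ [B mB <-]; exists (p @^-1` B); last by rewrite !setTI comp_preimage.
by exact: measurable_preimage.
Qed.

End generated_sigma_algebras.

Section subvectors.
Context {R : realType}.

Definition select {n m : nat} (f : 'I_m -> 'I_n) (t : n.-tuple R) : m.-tuple R :=
  [tuple tnth t (f i) | i < m].

Lemma measurable_select {n m : nat} (f : 'I_m -> 'I_n) :
  measurable_fun setT (select f).
Proof.
apply/measurable_fun_tnthP => i.
rewrite (_ : _ \o _ = (fun t : n.-tuple R => tnth t (f i))).
  exact: measurable_tnth.
by apply/funext => t; rewrite /= tnth_mktuple.
Qed.

Context {d} {T : measurableType d} (P : probability T R).

Lemma subvec_comp {n m l : nat} (X : 'I_n -> {RV P >-> R}) (f : 'I_m -> 'I_n)
  (g : 'I_l -> 'I_m) : subvec X (f \o g) = select g \o subvec X f.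
Proof.
by apply/funext => w; apply: eq_from_tnth => i; rewrite /= !tnth_mktuple.
Qed.

Lemma subvec_vec {n m : nat} (X : 'I_n -> {RV P >-> R}) (f : 'I_m -> 'I_n) :
  subvec X f = select f \o vec X.
Proof. exact: (subvec_comp X id f). Qed.

Lemma measurable_subvec {n m : nat} (X : 'I_n -> {RV P >-> R})
  (f : 'I_m -> 'I_n) : measurable_fun setT (subvec X f).
Proof.
apply/measurable_fun_tnthP => i.
rewrite (_ : _ \o _ = X (f i))//.
by apply/funext => t; rewrite /= tnth_mktuple.
Qed.

(** A ray for [f] is a ray for [g \o f], with the same or the opposite
   orientation. *)
Lemma strictly_monotone_generates (f : T -> R) (g : R -> R) :
  strictly_monotone g ->
  measurable_fun [set: g_sigma_algebra_preimageType (g \o f)] f.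
Proof.
move=> mg; apply: (measurability _ (RGenOInfty.measurableE R)) => //.
move=> _ [_ [a ->] <-]; rewrite setTI.
case: mg => [/le_mono/leW_mono gmono|g_decr].
  exists `]g a, +oo[%classic => //; rewrite setTI.
  by apply/seteqP; split => w /=; rewrite !in_itv /= !andbT gmono.
have /le_nmono/leW_nmono gmono : {homo g : x y /~ x < y} by move=> x y /g_decr.
exists `]-oo, g a[%classic => //; rewrite setTI.
by apply/seteqP; split => w /=; rewrite !in_itv /= !andbT gmono.
Qed.

End subvectors.

(** Each coordinate belongs either to the head or to the tail of the vector. *)
Lemma head_tail_generate (R : realType) (n k : nat) (hk : (k <= n)%N) :
  @measurable _ (n.-tuple R) =
  <<s preimage_pairs (@select R _ _ (widen_ord hk)) (select (tail_ord hk)) >>.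
Proof.
have mpre m (f : 'I_m -> 'I_n) (C : set (m.-tuple R)) : measurable C ->
    measurable (select f @^-1` C).
  by move=> mC; apply: measurable_preimage => //; exact: measurable_select.
apply/seteqP; split; last first.
  apply: smallest_sub; first exact: sigma_algebra_measurable.
  by move=> _ [C [B [mC mB ->]]]; apply: measurableI; exact: mpre.
move=> A mA.
suff mid : measurable_fun [set: g_sigma_algebraType
    (preimage_pairs (@select R _ _ (widen_ord hk)) (select (tail_ord hk)))]
    (@id (n.-tuple R)).
  by have := mid measurableT _ mA; rewrite setTI.
apply/measurable_fun_tnthP => i _ B mB; rewrite setTI.
apply: sub_sigma_algebra; rewrite /preimage_pairs /=.
have [ik|ki] := ltnP i k.
  exists ((fun t : k.-tuple R => tnth t (Ordinal ik)) @^-1` B), setT; split => //.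
    by apply: measurable_preimage => //; exact: measurable_tnth.
  rewrite preimage_setT setIT; apply/seteqP; split => t /=; rewrite tnth_mktuple;
    by rewrite (_ : widen_ord _ _ = i)//; exact: val_inj.
have ink : (i - k < n - k)%N by rewrite ltn_sub2r// (leq_ltn_trans ki).
exists setT, ((fun t : (n - k).-tuple R => tnth t (Ordinal ink)) @^-1` B).
split => //.
  by apply: measurable_preimage => //; exact: measurable_tnth.
rewrite preimage_setT setTI; apply/seteqP; split => t /=; rewrite tnth_mktuple;
  by rewrite (_ : tail_ord _ _ = i)//; apply: val_inj => /=; rewrite subnKC.
Qed.

(** * Properties of the dependence measure *)

Theorem corollary4 (disp : measure_display) (Omega : measurableType disp)
    (R : realType) (P : probability Omega R) (d : nat) (hd : (0 < d)%N)
    (X : 'I_d -> {RV P >-> R}) (Y : {RV P >-> R})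
    (cX : forall i : 'I_d, continuous (cdf (X i)))
    (cY : continuous (cdf Y)) :
  (* (i) *)
  (Tdep Y (vec X) = 1 <-> completely_dependent P Y (vec X)) /\
  (* (ii) *)
  (Tdep Y (vec X) = 0 <-> independent_rv P Y (vec X)) /\
  (* (iii) *)
  (forall s : 'S_d, Tdep Y (subvec X s) = Tdep Y (vec X)) /\
  (* (iv) *)
  (forall g : 'I_d -> R -> R,
     (forall i, continuous (g i)) -> (forall i, strictly_monotone (g i)) ->
     Tdep Y (fun w => [tuple g i (X i w) | i < d]) = Tdep Y (vec X)) /\
  (* (v) *)
  (forall (k l : nat) (hk : (k <= d)%N) (hl : (l <= d)%N),
     (0 < k)%N -> (k <= l)%N ->
     Tdep Y (subvec X (widen_ord hk)) <= Tdep Y (subvec X (widen_ord hl))) /\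
  (* (vi) *)
  (forall (k : nat) (hk : (k < d)%N), (0 < k)%N ->
     (Tdep Y (vec X) = Tdep Y (subvec X (widen_ord (ltnW hk))) <->
      cond_independent_rv P Y (subvec X (tail_ord (ltnW hk)))
        (subvec X (widen_ord (ltnW hk))))).
Proof.
have mX : measurable_fun setT (vec X) by exact: measurable_subvec.
split; [|split; [|split; [|split; [|split]]]].
- rewrite Tdep_eq1//; split; first exact: ge_moment_completely_dependent.
  exact: completely_dependent_ge_moment.
- rewrite Tdep_eq0//; split; first exact: ge_moment_independent.
  exact: independent_ge_moment.
- move=> s; apply: Tdep_eq_sigma; apply/seteqP; split.
    rewrite subvec_vec; apply: g_sigma_algebra_preimage_comp.
    exact: measurable_select.
  have -> : vec X = select (s^-1)%g \o subvec X s.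
    rewrite -subvec_comp; congr (subvec X _).
    by apply/funext => i; rewrite /= permKV.
  by apply: g_sigma_algebra_preimage_comp; exact: measurable_select.
- move=> g cg mg; apply: Tdep_eq_sigma; apply/seteqP; split.
    pose G (t : d.-tuple R) := [tuple g i (tnth t i) | i < d].
    have -> : (fun w => [tuple g i (X i w) | i < d]) = G \o vec X.
      by apply/funext => w; apply: eq_from_tnth => i; rewrite /= !tnth_mktuple.
    apply: g_sigma_algebra_preimage_comp; apply/measurable_fun_tnthP => i.
    rewrite (_ : _ \o _ = g i \o (fun t : d.-tuple R => tnth t i)).
      apply: measurableT_comp; last exact: measurable_tnth.
      exact: continuous_measurable_fun.
    by apply/funext => t; rewrite /= tnth_mktuple.
  apply: sub_g_sigma_algebra_preimage; apply/measurable_fun_tnthP => i.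
  rewrite (_ : _ \o _ = X i); last first.
    by apply/funext => t; rewrite /= tnth_mktuple.
  move=> _ B mB; rewrite setTI.
  have := @strictly_monotone_generates _ _ _ (X i) (g i) (mg i) measurableT B mB.
  rewrite setTI => -[C mC <-].
  exists ((fun t : d.-tuple R => tnth t i) @^-1` C).
    by apply: measurable_preimage => //; exact: measurable_tnth.
  by apply/seteqP; split => w /=; rewrite tnth_mktuple.
- move=> k l hk hl _ kl.
  have -> : subvec X (widen_ord hk) =
      select (widen_ord kl) \o subvec X (widen_ord hl).
    rewrite -subvec_comp; congr (subvec X _).
    by apply/funext => i; exact: val_inj.
  apply: Tdep_coarsening => //; first exact: measurable_subvec.
  exact: measurable_select.
- move=> k hk _; rewrite !(subvec_vec X (widen_ord _)) (subvec_vec X (tail_ord _)).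
  rewrite (eq_Tdep_coarsening cY mX (measurable_select _)); split.
    apply: regr_cond_independent => //; exact: measurable_select.
  apply: (cond_independent_regr mX) => //; try exact: measurable_select.
  exact: head_tail_generate.
Qed.
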